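(* Let $G$ be a finite abelian group and $\beta$ a bicharacter on $G$. Let $(\Gamma,L)$ be a matched pair of finite groups with $\rhd$ trivial (so that $\lhd:L\times\Gamma\to L$ is a right action by group automorphisms), let $\sigma:\Gamma\times\Gamma\to(\Bbbk^\times)^L$ and $\tau:L\times L\to(\Bbbk^\times)^\Gamma$ be normalized 2-cocycles with $\sigma_1(\gamma,\eta)=1$ and $\tau_1(l,t)=1$ for all $\gamma,\eta\in\Gamma$, $l,t\in L$, and let $H=\Bbbk^L\,{}^\tau\#_\sigma\Bbbk\Gamma$. Let $\widetilde z\in Z^1(\Gamma,\mathrm{Hom}(L,G))$ and suppose that for all $l,t\in L$ and $\gamma,\eta\in\Gamma$ $$\sigma_{lt}(\gamma,\eta)=\beta\big(\widetilde z(\gamma)(t),(\gamma\rightharpoonup\widetilde z(\eta))(l)\big)\,\sigma_l(\gamma,\eta)\,\sigma_t(\gamma,\eta).$$ Grade $H$ by $|\delta_le_\gamma|=\widetilde z(\gamma)(l)\in G$. Then $H$ is a $(G,\beta)$-color Hopf algebra if and only if $\widetilde\tau\in Z^1(\Gamma,Z^2(L,\Bbbk^\times))$, where $\widetilde\tau(\gamma)=\tau_\gamma$.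
   Context: $\Bbbk$ is an algebraically closed field of characteristic $0$. A bicharacter is a map $\beta:G\times G\to\Bbbk^\times$ multiplicative in each variable. A $(G,\beta)$-color Hopf algebra is a Hopf algebra in the braided category of $G$-graded vector spaces with braiding $c(v\otimes w)=\beta(|v|,|w|)w\otimes v$ for homogeneous $v,w$ of degrees $|v|,|w|$ (antipode bijective). A matched pair of groups $(\Gamma,L)$: finite groups $\Gamma,L$ with a right action $\lhd:L\times\Gamma\to L$ and a left action $\rhd:L\times\Gamma\to\Gamma$ (on sets) with $l\rhd\gamma\eta=(l\rhd\gamma)((l\lhd\gamma)\rhd\eta)$ and $lt\lhd\gamma=(l\lhd(t\rhd\gamma))(t\lhd\gamma)$. Here $\rhd$ is trivial: $l\rhd\gamma=\gamma$. Write $\sigma=\sum_l\sigma_l\delta_l$, $\tau=\sum_\gamma\tau_\gamma\delta_\gamma$. The cocycle conditions are $\sigma_l(\gamma,\eta)\sigma_l(\gamma\eta,\theta)=\sigma_{l\lhd\gamma}(\eta,\theta)\sigma_l(\gamma,\eta\theta)$ and $\tau_\gamma(rs,t)\,\tau_{t\rhd\gamma}(r,s)=\tau_\gamma(r,st)\,\tau_\gamma(s,t)$ (with $t\rhd\gamma=\gamma$ here), normalized: value $1$ when one of the two arguments is $1$. $H=\Bbbk^L\,{}^\tau\#_\sigma\Bbbk\Gamma$ is the vector space $\Bbbk^L\otimes\Bbbk\Gamma$ with basis $\delta_le_\gamma$, product $(\delta_le_\gamma)(\delta_te_\eta)=\delta_{l\lhd\gamma,t}\,\sigma_l(\gamma,\eta)\,\delta_le_{\gamma\eta}$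 and coproduct $\Delta(\delta_le_\gamma)=\sum_{u\in L}\tau_\gamma(u,u^{-1}l)\,\delta_ue_{(u^{-1}l)\rhd\gamma}\otimes\delta_{u^{-1}l}e_\gamma$. $\Gamma$ acts on $\mathrm{Hom}(L,G)$ by $(\gamma\rightharpoonup\phi)(l)=\phi(l\lhd\gamma)$ and on $Z^2(L,\Bbbk^\times)$ (normalized 2-cocycles on $L$ with trivial action on $\Bbbk^\times$) by $(\gamma\cdot\varphi)(l,t)=\varphi(l\lhd\gamma,t\lhd\gamma)$. $Z^1(\Gamma,M)$ denotes the normalized 1-cocycles: maps $f:\Gamma\to M$ with $f(\gamma\eta)=f(\gamma)\,(\gamma\cdot f(\eta))$. *)

(* Defs.v *)
From HB Require Import structures.
From mathcomp Require Import all_boot all_order all_algebra all_fingroup.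

Set Implicit Arguments.
Unset Strict Implicit.
Unset Printing Implicit Defensive.

Import GRing.Theory.
Local Open Scope ring_scope.

(** A finite-dimensional vector space is given by a finite type [I] indexing a
    basis, as [{ffun I -> k^o}]; a [G]-grading is a degree [d : I -> G] on the
    basis, and [{ffun I * J -> k^o}] is the tensor product. *)
Notation "''V[' k ]_ I" := ({ffun I -> k^o})
  (at level 8, k at level 200, I at level 2, format "''V[' k ]_ I") : type_scope.

Section Spaces.

Variable k : fieldType.

Definition basis_vec (I : finType) (i : I) : 'V[k]_I := [ffun j => (i == j)%:R].

(** Linear extension of a map defined on the basis. *)
Definition lin_ext (I : finType) (W : lmodType k) (F : I -> W) (v : 'V[k]_I) : W :=
  \sum_(i : I) (v i : k) *: F i.

Lemma lin_ext_is_linear (I : finType) (W : lmodType k) (F : I -> W) :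
  linear (lin_ext F).
Proof.
move=> a u v; rewrite /lin_ext scaler_sumr -big_split /=.
by apply: eq_bigr => i _; rewrite !ffunE scalerDl scalerA.
Qed.

HB.instance Definition _ (I : finType) (W : lmodType k) (F : I -> W) :=
  GRing.isLinear.Build k 'V[k]_I W *:%R (lin_ext F) (lin_ext_is_linear F).

Lemma lin_ext_basis (I : finType) (W : lmodType k) (F : I -> W) (i : I) :
  lin_ext F (basis_vec i) = F i.
Proof.
rewrite /lin_ext (bigD1 i) //= big1 => [|j ji].
  by rewrite ffunE eqxx scale1r addr0.
by rewrite ffunE eq_sym (negbTE ji) scale0r.
Qed.

Definition tens (I J : finType) (v : 'V[k]_I) (w : 'V[k]_J) : 'V[k]_(I * J)%type :=
  [ffun p : I * J => (v p.1 : k) * w p.2].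

Definition tensor_map (I J I' J' : finType)
    (f : 'V[k]_I -> 'V[k]_I') (g : 'V[k]_J -> 'V[k]_J') :
    'V[k]_(I * J)%type -> 'V[k]_(I' * J')%type :=
  lin_ext (fun p : I * J => tens (f (basis_vec p.1)) (g (basis_vec p.2))).

Definition assoc (I J K : finType) (w : 'V[k]_(I * J * K)%type) :
    'V[k]_(I * (J * K))%type :=
  [ffun p : I * (J * K) => w ((p.1, p.2.1), p.2.2)].

Definition unassoc (I J K : finType) (w : 'V[k]_(I * (J * K))%type) :
    'V[k]_(I * J * K)%type :=
  [ffun p : I * J * K => w (p.1.1, (p.1.2, p.2))].

Variable G : finGroupType.

Definition homogeneous (I : finType) (d : I -> G) (g : G) (v : 'V[k]_I) : Prop :=
  forall i : I, v i != 0 -> d i = g.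

Definition graded_map (I J : finType) (dI : I -> G) (dJ : J -> G)
    (f : 'V[k]_I -> 'V[k]_J) : Prop :=
  forall (g : G) (v : 'V[k]_I), homogeneous dI g v -> homogeneous dJ g (f v).

Definition tensor_deg (I J : finType) (dI : I -> G) (dJ : J -> G) (p : I * J) : G :=
  (dI p.1 * dJ p.2)%g.

Definition bicharacter (beta : G -> G -> k) : Prop :=
  [/\ forall g h : G, beta g h != 0,
      forall g g' h : G, beta (g * g')%g h = beta g h * beta g' h &
      forall g h h' : G, beta g (h * h')%g = beta g h * beta g h'].

Variable beta : G -> G -> k.

Definition braiding (I J : finType) (dI : I -> G) (dJ : J -> G) :
    'V[k]_(I * J)%type -> 'V[k]_(J * I)%type :=
  lin_ext (fun p : I * J =>
    beta (dI p.1) (dJ p.2) *: tens (basis_vec p.2) (basis_vec p.1)).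

Lemma braiding_homogeneous (I J : finType) (dI : I -> G) (dJ : J -> G)
    (g h : G) (v : 'V[k]_I) (w : 'V[k]_J) :
  homogeneous dI g v -> homogeneous dJ h w ->
  braiding dI dJ (tens v w) = beta g h *: tens w v.
Proof.
move=> hv hw; apply/ffunP => -[j i].
rewrite /braiding /lin_ext sum_ffunE !ffunE /= (bigD1 (i, j)) //= big1.
  rewrite !ffunE /= !eqxx mulr1 addr0 /GRing.scale /= mulr1.
  have [->|vi] := eqVneq (v i) 0; first by rewrite !(mul0r, mulr0).
  have [->|wj] := eqVneq (w j) 0; first by rewrite !(mul0r, mulr0).
  by rewrite (hv i vi) (hw j wj) mulrC [v i * _]mulrC.
move=> [i' j'] /= ne; rewrite !ffunE /= -natrM mulnb.
by case: andP ne => [[/eqP -> /eqP ->]|]; rewrite ?eqxx // !scaler0.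
Qed.

(** [id (x) c (x) id] on [(V (x) V) (x) (V (x) V)], with its associators. *)
Definition mid_braiding (I : finType) (d : I -> G) (w : 'V[k]_((I * I) * (I * I))%type) :
    'V[k]_((I * I) * (I * I))%type :=
  unassoc (tensor_map id
    (fun u : 'V[k]_(I * (I * I))%type =>
       assoc (tensor_map (braiding d d) id (unassoc u)))
    (assoc w)).

Lemma tens_basis (I J : finType) (i : I) (j : J) :
  tens (basis_vec i) (basis_vec j) = basis_vec (i, j).
Proof. by apply/ffunP => -[i' j']; rewrite !ffunE /= -natrM mulnb. Qed.

Lemma mid_braiding_basis (I : finType) (d : I -> G) (a b a' b' : I) :
  mid_braiding d (basis_vec ((a, b), (a', b')))
    = beta (d b) (d a') *: basis_vec ((a, a'), (b, b')).
Proof.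
have assocE (A B C : finType) (x : A) (y : B) (t : C) :
    assoc (basis_vec ((x, y), t)) = basis_vec (x, (y, t)).
  by apply/ffunP => -[? [? ?]]; rewrite !ffunE /= !xpair_eqE /= andbA.
have unassocE (A B C : finType) (x : A) (y : B) (t : C) :
    unassoc (basis_vec (x, (y, t))) = basis_vec ((x, y), t).
  by apply/ffunP => -[[? ?] ?]; rewrite !ffunE /= !xpair_eqE /= andbA.
have tensZr (A B : finType) (r : k) (v : 'V[k]_A) (w : 'V[k]_B) :
    tens v (r *: w) = r *: tens v w.
  by apply/ffunP => p; rewrite !ffunE /GRing.scale /= mulrCA.
have tensZl (A B : finType) (r : k) (v : 'V[k]_A) (w : 'V[k]_B) :
    tens (r *: v) w = r *: tens v w.
  by apply/ffunP => p; rewrite !ffunE /GRing.scale /= mulrA.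
have assocZ (A B C : finType) (r : k) (w : 'V[k]_(A * B * C)%type) :
    assoc (r *: w) = r *: assoc w by apply/ffunP => p; rewrite !ffunE.
have unassocZ (A B C : finType) (r : k) (w : 'V[k]_(A * (B * C))%type) :
    unassoc (r *: w) = r *: unassoc w by apply/ffunP => p; rewrite !ffunE.
rewrite /mid_braiding assocE /tensor_map lin_ext_basis /= unassocE.
rewrite !lin_ext_basis /= /braiding lin_ext_basis /= tensZl assocZ !tens_basis.
by rewrite assocE tensZr unassocZ tens_basis unassocE.
Qed.

Definition tensor_square_mul (I : finType) (d : I -> G)
    (mul : 'V[k]_(I * I)%type -> 'V[k]_I) (x y : 'V[k]_(I * I)%type) :
    'V[k]_(I * I)%type :=
  tensor_map mul mul (mid_braiding d (tens x y)).

Record color_algebra (I : finType) (d : I -> G)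
    (mul : {linear 'V[k]_(I * I)%type -> 'V[k]_I}) (one : 'V[k]_I) : Prop :=
  ColorAlgebra {
    color_mulA : forall x y z : 'V[k]_I,
      mul (tens (mul (tens x y)) z) = mul (tens x (mul (tens y z)));
    color_mul1l : forall x : 'V[k]_I, mul (tens one x) = x;
    color_mul1r : forall x : 'V[k]_I, mul (tens x one) = x;
    color_mul_graded : graded_map (tensor_deg d d) d mul;
    color_one_graded : homogeneous d 1%g one }.

Record color_coalgebra (I : finType) (d : I -> G)
    (comul : {linear 'V[k]_I -> 'V[k]_(I * I)%type})
    (counit : {linear 'V[k]_I -> k^o}) : Prop :=
  ColorCoalgebra {
    color_comulA : forall x : 'V[k]_I,
      assoc (tensor_map comul id (comul x)) = tensor_map id comul (comul x);
    color_counitl : forall x : 'V[k]_I,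
      lin_ext (fun p : I * I => (counit (basis_vec p.1) : k) *: basis_vec p.2)
        (comul x) = x;
    color_counitr : forall x : 'V[k]_I,
      lin_ext (fun p : I * I => (counit (basis_vec p.2) : k) *: basis_vec p.1)
        (comul x) = x;
    color_comul_graded : graded_map d (tensor_deg d d) comul;
    color_counit_graded : forall (g : G) (x : 'V[k]_I),
      homogeneous d g x -> counit x != 0 -> g = 1%g }.

Record color_bialgebra (I : finType) (d : I -> G)
    (mul : {linear 'V[k]_(I * I)%type -> 'V[k]_I}) (one : 'V[k]_I)
    (comul : {linear 'V[k]_I -> 'V[k]_(I * I)%type})
    (counit : {linear 'V[k]_I -> k^o}) : Prop :=
  ColorBialgebra {
    color_bialgebra_alg : color_algebra d mul one;
    color_bialgebra_coalg : color_coalgebra d comul counit;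
    color_comulM : forall x y : 'V[k]_I,
      comul (mul (tens x y)) = tensor_square_mul d mul (comul x) (comul y);
    color_comul1 : comul one = tens one one;
    color_counitM : forall x y : 'V[k]_I,
      counit (mul (tens x y)) = (counit x : k) * counit y;
    color_counit1 : counit one = 1 }.

Record color_antipode (I : finType) (d : I -> G)
    (mul : {linear 'V[k]_(I * I)%type -> 'V[k]_I}) (one : 'V[k]_I)
    (comul : {linear 'V[k]_I -> 'V[k]_(I * I)%type})
    (counit : {linear 'V[k]_I -> k^o})
    (S : {linear 'V[k]_I -> 'V[k]_I}) : Prop :=
  ColorAntipode {
    color_antipode_graded : graded_map d d S;
    color_antipode_bij : bijective S;
    color_antipodel : forall x : 'V[k]_I,
      mul (tensor_map S id (comul x)) = (counit x : k) *: one;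
    color_antipoder : forall x : 'V[k]_I,
      mul (tensor_map id S (comul x)) = (counit x : k) *: one }.

(** Unit, counit and antipode are determined by the product and the coproduct,
    so they are quantified existentially. *)
Definition color_hopf_algebra (I : finType) (d : I -> G)
    (mul : {linear 'V[k]_(I * I)%type -> 'V[k]_I})
    (comul : {linear 'V[k]_I -> 'V[k]_(I * I)%type}) : Prop :=
  exists (one : 'V[k]_I) (counit : {linear 'V[k]_I -> k^o})
         (S : {linear 'V[k]_I -> 'V[k]_I}),
    color_bialgebra d mul one comul counit
    /\ color_antipode d mul one comul counit S.

End Spaces.

Record matched_pair (Gam L : finGroupType) := MatchedPair {
  mp_ract : {action Gam &-> L};
  mp_lact : L -> Gam -> Gam;
  mp_lact1 : forall c : Gam, mp_lact 1%g c = c;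
  mp_lactM : forall (l t : L) (c : Gam),
    mp_lact (l * t)%g c = mp_lact l (mp_lact t c);
  mp_lact_mul : forall (l : L) (c e : Gam),
    mp_lact l (c * e)%g = (mp_lact l c * mp_lact (mp_ract l c) e)%g;
  mp_ract_mul : forall (l t : L) (c : Gam),
    mp_ract (l * t)%g c = (mp_ract l (mp_lact t c) * mp_ract t c)%g }.

Notation "l <|[ M ] c" := (mp_ract M l c)
  (at level 40, M at level 200, format "l  <|[ M ]  c") : group_scope.
Notation "l |>[ M ] c" := (mp_lact M l c)
  (at level 40, M at level 200, format "l  |>[ M ]  c") : group_scope.

Section CrossedProduct.

Variables (k : fieldType) (Gam L : finGroupType) (M : matched_pair Gam L).

Implicit Types (sigma : L -> Gam -> Gam -> k) (tau : Gam -> L -> L -> k).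

(** [sigma l c e] is the component at [l] of the value at [(c, e)], and
    [tau c l t] the component at [c] of the value at [(l, t)]. *)
Record sigma_cocycle sigma : Prop := SigmaCocycle {
  sigma_neq0 : forall (l : L) (c e : Gam), sigma l c e != 0;
  sigma_cocycleP : forall (l : L) (c e h : Gam),
    sigma l c e * sigma l (c * e)%g h
      = sigma (l <|[M] c)%g e h * sigma l c (e * h)%g;
  sigma_norml : forall (l : L) (e : Gam), sigma l 1%g e = 1;
  sigma_normr : forall (l : L) (c : Gam), sigma l c 1%g = 1 }.

Record tau_cocycle tau : Prop := TauCocycle {
  tau_neq0 : forall (c : Gam) (l t : L), tau c l t != 0;
  tau_cocycleP : forall (c : Gam) (r s t : L),
    tau c (r * s)%g t * tau (t |>[M] c)%g r s
      = tau c r (s * t)%g * tau c s t;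
  tau_norml : forall (c : Gam) (t : L), tau c 1%g t = 1;
  tau_normr : forall (c : Gam) (l : L), tau c l 1%g = 1 }.

(** The basis vector indexed by [(l, c) : L * Gam] is [delta_l e_c]. *)
Definition crossed_mul sigma : 'V[k]_((L * Gam) * (L * Gam))%type -> 'V[k]_(L * Gam)%type :=
  lin_ext (fun p : (L * Gam) * (L * Gam) =>
    let: ((l, c), (t, e)) := p in
    (((l <|[M] c)%g == t)%:R * sigma l c e) *: basis_vec k (l, (c * e)%g)).

HB.instance Definition _ sigma := GRing.Linear.on (crossed_mul sigma).

Definition crossed_comul tau : 'V[k]_(L * Gam)%type -> 'V[k]_((L * Gam) * (L * Gam))%type :=
  lin_ext (fun p : L * Gam =>
    let: (l, c) := p in
    \sum_(u : L) tau c u (u^-1 * l)%g *: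
      tens (basis_vec k (u, ((u^-1 * l) |>[M] c)%g))
           (basis_vec k ((u^-1 * l)%g, c))).

HB.instance Definition _ tau := GRing.Linear.on (crossed_comul tau).

End CrossedProduct.

(** Normalized 1-cocycles of [Gam] in a group [N] of functions [X -> A] under
    pointwise multiplication, on which [Gam] acts by [act]. *)
Record Z1 (Gam : finGroupType) (X A : Type) (mulA : A -> A -> A) (oneA : A)
    (N : (X -> A) -> Prop) (act : Gam -> (X -> A) -> X -> A)
    (f : Gam -> X -> A) : Prop := MkZ1 {
  Z1_mem : forall c : Gam, N (f c);
  Z1_norm : forall x : X, f 1%g x = oneA;
  Z1_cocycle : forall (c e : Gam) (x : X),
    f (c * e)%g x = mulA (f c x) (act c (f e) x) }.

Section Coefficients.

Variables (Gam L : finGroupType) (M : matched_pair Gam L).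

Definition is_Hom (G : finGroupType) (phi : L -> G) : Prop :=
  {morph phi : l t / (l * t)%g}.

Definition Hom_act (G : finGroupType) (c : Gam) (phi : L -> G) : L -> G :=
  fun l => phi (l <|[M] c)%g.

Definition Z1_Hom (G : finGroupType) (z : Gam -> L -> G) : Prop :=
  Z1 (fun g h : G => (g * h)%g) 1%g (@is_Hom G) (@Hom_act G) z.

Variable k : fieldType.

Record is_Z2 (phi : L * L -> k) : Prop := IsZ2 {
  Z2_neq0 : forall l t : L, phi (l, t) != 0;
  Z2_cocycle : forall l t r : L,
    phi (l, t) * phi ((l * t)%g, r) = phi (t, r) * phi (l, (t * r)%g);
  Z2_norml : forall t : L, phi (1%g, t) = 1;
  Z2_normr : forall l : L, phi (l, 1%g) = 1 }.

Definition Z2_act (c : Gam) (phi : L * L -> k) : L * L -> k :=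
  fun p => phi ((p.1 <|[M] c)%g, (p.2 <|[M] c)%g).

Definition Z1_Z2 (f : Gam -> L * L -> k) : Prop :=
  Z1 (@GRing.mul k) 1 is_Z2 Z2_act f.

Definition tau_tilde (tau : Gam -> L -> L -> k) (c : Gam) : L * L -> k :=
  fun p => tau c p.1 p.2.

Definition crossed_deg (G : finGroupType) (z : Gam -> L -> G) (p : L * Gam) : G :=
  z p.2 p.1.

End Coefficients.

(* Main.v *)
Require Import Defs.
From HB Require Import structures.
From mathcomp Require Import all_boot all_order all_algebra all_fingroup.
Set Implicit Arguments.
Unset Strict Implicit.
Unset Printing Implicit Defensive.
Import GRing.Theory.
Local Open Scope ring_scope.

(** On basis vectors, the coproduct of [(delta_l e_c)(delta_t e_e)] has
    coefficients [sigma_l(c,e) tau_ce(u,v)] with [uv = l], while the braided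
    product of the coproducts has coefficients
    [beta(z(c)(v), z(e)(u <| c)) sigma_u(c,e) sigma_v(c,e)
     tau_c(u,v) tau_e(u <| c, v <| c)].
    By the hypothesis relating [sigma] and [z], these agree exactly when
    [tau_ce(u,v) = tau_c(u,v) tau_e(u <| c, v <| c)]. All the other axioms of a
    color Hopf algebra hold without this condition, with unit
    [sum_l delta_l e_1], counit [delta_l e_c |-> [l = 1]], and antipode sending
    [delta_l e_c] to a multiple of [delta_(l^-1 <| c) e_(c^-1)]. *)

(** * Linear maps determined by a basis, and the braided product of tensors *)

Section LinearMaps.

Variable k : fieldType.
Implicit Types I J K : finType.

Lemma vec_sum I (v : 'V[k]_I) : v = \sum_i (v i : k) *: basis_vec k i.
Proof.
apply/ffunP => j; rewrite sum_ffunE (bigD1 j) //= big1 => [|i ij].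
  by rewrite !ffunE eqxx addr0 /GRing.scale /= mulr1.
by rewrite !ffunE (negbTE ij) scaler0.
Qed.

(** Linearity is a hypothesis on a plain function, since the maps met below are mostly composites,
    such as [fun x => mul (tens x y)], that carry no bundled linear structure. *)
Lemma linear_fun_sumZ I J (W : lmodType k) (f : 'V[k]_I -> W)
    (a : J -> k) (w : J -> 'V[k]_I) :
  linear f -> f (\sum_j a j *: w j) = \sum_j a j *: f (w j).
Proof.
move=> lf; have f0 : f 0 = 0.
  by move: (lf (-1) 0 0); rewrite scaler0 addr0 scaleN1r addNr.
by elim/big_rec2: _ => [|j u v _ <-]; [exact: f0 | rewrite lf].
Qed.

Lemma linear_fun_sum I J (W : lmodType k) (f : 'V[k]_I -> W) (w : J -> 'V[k]_I) :
  linear f -> f (\sum_j w j) = \sum_j f (w j).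
Proof.
move=> lf; rewrite (eq_bigr (fun j => (1 : k) *: w j)) => [|j _].
  by rewrite linear_fun_sumZ //; apply: eq_bigr => j _; rewrite scale1r.
by rewrite scale1r.
Qed.

Lemma linear_eq_basis I (W : lmodType k) (f g : 'V[k]_I -> W) :
  linear f -> linear g ->
  (forall i, f (basis_vec k i) = g (basis_vec k i)) -> f =1 g.
Proof.
move=> lf lg fg v; rewrite (vec_sum v) !linear_fun_sumZ //.
by apply: eq_bigr => i _; rewrite fg.
Qed.

Lemma tens_linearl I J (w : 'V[k]_J) : linear (fun v : 'V[k]_I => tens v w).
Proof.
by move=> a u v; apply/ffunP => p; rewrite !ffunE /GRing.scale /= mulrDl mulrA.
Qed.

Lemma tens_linearr I J (v : 'V[k]_I) : linear (@tens k I J v).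
Proof.
move=> a u w; apply/ffunP => p.
by rewrite !ffunE /GRing.scale /= mulrDr mulrCA.
Qed.

Lemma tensZl I J a (v : 'V[k]_I) (w : 'V[k]_J) :
  tens (a *: v) w = a *: tens v w.
Proof. by apply/ffunP => p; rewrite !ffunE /GRing.scale /= mulrA. Qed.

Lemma tensZr I J a (v : 'V[k]_I) (w : 'V[k]_J) :
  tens v (a *: w) = a *: tens v w.
Proof. by apply/ffunP => p; rewrite !ffunE /GRing.scale /= mulrCA. Qed.

Lemma tensor_map_linear I J I' J' (f : 'V[k]_I -> 'V[k]_I')
    (g : 'V[k]_J -> 'V[k]_J') : linear (tensor_map f g).
Proof. by move=> a u v; rewrite /tensor_map linearP. Qed.

Lemma tensor_map_basis I J I' J' (f : 'V[k]_I -> 'V[k]_I')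
    (g : 'V[k]_J -> 'V[k]_J') i j :
  tensor_map f g (basis_vec k (i, j)) = tens (f (basis_vec k i)) (g (basis_vec k j)).
Proof. exact: lin_ext_basis. Qed.

Lemma assoc_linear I J K : linear (@assoc k I J K).
Proof. by move=> a u v; apply/ffunP => p; rewrite !ffunE. Qed.

Lemma assoc_basis I J K (i : I) (j : J) (l : K) :
  assoc (basis_vec k ((i, j), l)) = basis_vec k (i, (j, l)).
Proof. by apply/ffunP => -[? [? ?]]; rewrite !ffunE /= !xpair_eqE /= andbA. Qed.

Lemma unassoc_linear I J K : linear (@unassoc k I J K).
Proof. by move=> a u v; apply/ffunP => p; rewrite !ffunE. Qed.

Variables (G : finGroupType) (beta : G -> G -> k).

(** Expand [v] in the basis. If [dJ j] differs from [g], each summand of the coefficient of [f v] at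
    [j] vanishes: either [v i = 0], or [dI i = g] and [f (basis_vec k i)] has no component at
    [j]. *)
Lemma graded_map_basis I J (dI : I -> G) (dJ : J -> G) (f : 'V[k]_I -> 'V[k]_J) :
  linear f ->
  (forall i j, f (basis_vec k i) j != 0 -> dJ j = dI i) ->
  graded_map dI dJ f.
Proof.
move=> lf fd g v hv j; rewrite (vec_sum v) linear_fun_sumZ // sum_ffunE => nz.
apply/eqP; apply: contraNT nz => djg; rewrite big1 // => i _; rewrite ffunE.
have [->|vi] := eqVneq (v i) 0; first by rewrite scale0r.
apply/eqP; rewrite scaler_eq0; apply/orP; right.
by apply: contraNT djg => /fd ->; rewrite (hv i vi).
Qed.

Lemma mid_braiding_linear I (d : I -> G) : linear (mid_braiding beta d).
Proof.
move=> a u v; rewrite /mid_braiding.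
by rewrite assoc_linear tensor_map_linear unassoc_linear.
Qed.

Lemma tensor_square_mul_linearl I (d : I -> G)
    (mul : 'V[k]_(I * I)%type -> 'V[k]_I) (y : 'V[k]_(I * I)%type) :
  linear (fun x => tensor_square_mul beta d mul x y).
Proof.
move=> a u v; rewrite /tensor_square_mul.
by rewrite tens_linearl mid_braiding_linear tensor_map_linear.
Qed.

Lemma tensor_square_mul_linearr I (d : I -> G)
    (mul : 'V[k]_(I * I)%type -> 'V[k]_I) (x : 'V[k]_(I * I)%type) :
  linear (tensor_square_mul beta d mul x).
Proof.
move=> a u v; rewrite /tensor_square_mul.
by rewrite tens_linearr mid_braiding_linear tensor_map_linear.
Qed.

Lemma tensor_square_mul_basis I (d : I -> G)
    (mul : 'V[k]_(I * I)%type -> 'V[k]_I) (a b a' b' : I) :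
  tensor_square_mul beta d mul (basis_vec k (a, b)) (basis_vec k (a', b'))
    = beta (d b) (d a') *:
        tens (mul (basis_vec k (a, a'))) (mul (basis_vec k (b, b'))).
Proof.
rewrite /tensor_square_mul tens_basis mid_braiding_basis.
(* Adding 0 gives the argument the shape [a *: u + v] in which linearity is stated. *)
by rewrite -[_ *: basis_vec _ _]addr0 tensor_map_linear tensor_map_basis
  /tensor_map linear0 addr0.
Qed.

End LinearMaps.

(** * The crossed product for a trivial left action: values on basis vectors *)

Section CrossedProductTheory.

Variables (k : fieldType) (Gam L : finGroupType) (M : matched_pair Gam L).
Variables (sigma : L -> Gam -> Gam -> k) (tau : Gam -> L -> L -> k).
Hypothesis lact_trivial : forall (l : L) (c : Gam), (l |>[M] c)%g = c.
Hypothesis sigmaP : sigma_cocycle M sigma.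
Hypothesis tauP : tau_cocycle M tau.

Local Notation mul := (crossed_mul M sigma).
Local Notation comul := (crossed_comul M tau).
Local Notation B := (basis_vec k).

Lemma ractM (l t : L) c : ((l * t) <|[M] c)%g = ((l <|[M] c) * (t <|[M] c))%g.
Proof. by rewrite mp_ract_mul lact_trivial. Qed.

Lemma ract1g c : (1 <|[M] c = 1)%g.
Proof. by apply: (mulgI (1 <|[M] c)%g); rewrite -ractM !mulg1. Qed.

Lemma ractV (l : L) c : (l^-1 <|[M] c = (l <|[M] c)^-1)%g.
Proof. by apply: (mulgI (l <|[M] c)%g); rewrite -ractM !mulgV ract1g. Qed.

Lemma crossed_mul_pair l c t e :
  mul (B ((l, c), (t, e))) =
    (((l <|[M] c)%g == t)%:R * sigma l c e) *: B (l, (c * e)%g).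
Proof. exact: lin_ext_basis. Qed.

Lemma crossed_mul_basis l c t e :
  mul (tens (B (l, c)) (B (t, e))) =
    (((l <|[M] c)%g == t)%:R * sigma l c e) *: B (l, (c * e)%g).
Proof. by rewrite tens_basis crossed_mul_pair. Qed.

Lemma crossed_comul_basis l c :
  comul (B (l, c)) = \sum_u tau c u (u^-1 * l)%g *: B ((u, c), ((u^-1 * l)%g, c)).
Proof.
rewrite /crossed_comul lin_ext_basis; apply: eq_bigr => u _.
by rewrite lact_trivial tens_basis.
Qed.

Definition crossed_one : 'V[k]_(L * Gam)%type := \sum_l B (l, 1%g).

Definition crossed_counit : 'V[k]_(L * Gam)%type -> k^o :=
  lin_ext (fun p : L * Gam => (p.1 == 1%g)%:R : k^o).

HB.instance Definition _ := GRing.Linear.on crossed_counit.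

Lemma crossed_counit_basis l c : crossed_counit (B (l, c)) = (l == 1%g)%:R.
Proof. exact: lin_ext_basis. Qed.

(** The coefficient is forced by the left antipode axiom. *)
Definition antipode_coef (p : L * Gam) : k :=
  (tau p.2 p.1 p.1^-1%g * sigma (p.1^-1 <|[M] p.2)%g p.2^-1%g p.2)^-1.

(** Kept apart from the coefficient because it is an involution of the basis, which yields the
    inverse of the antipode. *)
Definition antipode_index (p : L * Gam) : L * Gam :=
  ((p.1^-1 <|[M] p.2)%g, p.2^-1%g).

Definition crossed_antipode : 'V[k]_(L * Gam)%type -> 'V[k]_(L * Gam)%type :=
  lin_ext (fun p => antipode_coef p *: B (antipode_index p)).

HB.instance Definition _ := GRing.Linear.on crossed_antipode.

Lemma crossed_antipode_basis p :
  crossed_antipode (B p) = antipode_coef p *: B (antipode_index p).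
Proof. exact: lin_ext_basis. Qed.

(** * Algebra and coalgebra axioms *)

Lemma crossed_mul_linear : linear mul.
Proof. by move=> a u v; rewrite linearP. Qed.

Lemma crossed_comul_linear : linear comul.
Proof. by move=> a u v; rewrite linearP. Qed.

Lemma crossed_mul_linearl (y : 'V[k]_(L * Gam)%type) :
  linear (fun x : 'V[k]_(L * Gam)%type => mul (tens x y)).
Proof. by move=> a u v; rewrite tens_linearl crossed_mul_linear. Qed.

Lemma crossed_mul_linearr (x : 'V[k]_(L * Gam)%type) :
  linear (fun y : 'V[k]_(L * Gam)%type => mul (tens x y)).
Proof. by move=> a u v; rewrite tens_linearr crossed_mul_linear. Qed.

Lemma crossed_mulA (x y w : 'V[k]_(L * Gam)%type) :
  mul (tens (mul (tens x y)) w) = mul (tens x (mul (tens y w))).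
Proof.
move: x; apply: linear_eq_basis => [a u v|a u v|[l c]].
- by rewrite !crossed_mul_linearl.
- by rewrite crossed_mul_linearl.
move: y; apply: linear_eq_basis => [a u v|a u v|[t e]].
- by rewrite crossed_mul_linearr crossed_mul_linearl.
- by rewrite crossed_mul_linearl crossed_mul_linearr.
move: w; apply: linear_eq_basis => [a u v|a u v|[r h]].
- by rewrite crossed_mul_linearr.
- by rewrite !crossed_mul_linearr.
rewrite !crossed_mul_basis tensZl tensZr.
rewrite !linearZ /= !crossed_mul_basis !scalerA mulgA actM; congr (_ *: _).
(* Both sides vanish unless [t = l <| c] and [r = t <| e]; in that case the scalars agree by the
   cocycle condition on [sigma]. *)
have [<-|_] := eqVneq; last by rewrite !(mul0r, mulr0).
case: eqP => _; rewrite ?(mul0r, mulr0) //= !mul1r.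
exact: sigma_cocycleP sigmaP _ _ _ _.
Qed.

Lemma crossed_mul1l (x : 'V[k]_(L * Gam)%type) : mul (tens crossed_one x) = x.
Proof.
move: x; apply: linear_eq_basis => [|//|[t e]]; first exact: crossed_mul_linearr.
rewrite (linear_fun_sum _ (@crossed_mul_linearl _)) (bigD1 t) //= big1 => [|l lt].
  by rewrite crossed_mul_basis act1 eqxx (sigma_norml sigmaP) mul1r mul1g scale1r addr0.
by rewrite crossed_mul_basis act1 (negbTE lt) mul0r scale0r.
Qed.

Lemma crossed_mul1r (x : 'V[k]_(L * Gam)%type) : mul (tens x crossed_one) = x.
Proof.
move: x; apply: linear_eq_basis => [|//|[l c]]; first exact: crossed_mul_linearl.
rewrite (linear_fun_sum _ (@crossed_mul_linearr _))
  (bigD1 (l <|[M] c)%g) //= big1 => [|t lt].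
  by rewrite crossed_mul_basis eqxx (sigma_normr sigmaP) mul1r mulg1 scale1r addr0.
by rewrite crossed_mul_basis eq_sym (negbTE lt) mul0r scale0r.
Qed.

Lemma crossed_comulA (x : 'V[k]_(L * Gam)%type) :
  assoc (tensor_map comul id (comul x)) = tensor_map id comul (comul x).
Proof.
move: x; apply: linear_eq_basis => [a u v|a u v|[l c]].
- by rewrite crossed_comul_linear tensor_map_linear assoc_linear.
- by rewrite crossed_comul_linear tensor_map_linear.
rewrite crossed_comul_basis !(linear_fun_sumZ _ _ (@tensor_map_linear _ _ _ _ _ _ _)).
rewrite (linear_fun_sumZ _ _ (@assoc_linear _ _ _ _)).
(* Both iterated coproducts run over the factorisations of [l] into three factors; here they are
   [v], [v^-1 u] and [u^-1 l]. *)
pose F u v : 'V[k]_((L * Gam) * ((L * Gam) * (L * Gam)))%type :=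
  (tau c u (u^-1 * l)%g * tau c v (v^-1 * u)%g) *:
    B ((v, c), (((v^-1 * u)%g, c), ((u^-1 * l)%g, c))).
transitivity (\sum_u \sum_v F u v).
  apply: eq_bigr => u _; rewrite tensor_map_basis crossed_comul_basis.
  rewrite (linear_fun_sumZ _ _ (@tens_linearl _ _ _ _)).
  rewrite (linear_fun_sumZ _ _ (@assoc_linear _ _ _ _)) scaler_sumr.
  by apply: eq_bigr => v _; rewrite tens_basis assoc_basis scalerA.
rewrite exchange_big; apply: eq_bigr => v _ /=.
rewrite tensor_map_basis crossed_comul_basis.
rewrite (linear_fun_sumZ _ _ (@tens_linearr _ _ _ _)) scaler_sumr.
(* With [u = v w] the factors become [v], [w] and [w^-1 v^-1 l], and the cocycle condition on [tau]
   at this triple equates the coefficients. *)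
rewrite (reindex_inj (mulgI v)); apply: eq_bigr => w _.
rewrite tens_basis scalerA /F mulKg invMg -mulgA; congr (_ *: _).
have := tau_cocycleP tauP c v w (w^-1 * (v^-1 * l))%g.
by rewrite lact_trivial mulKVg.
Qed.

Lemma crossed_counitl (x : 'V[k]_(L * Gam)%type) :
  lin_ext (fun p : (L * Gam) * (L * Gam) =>
    (crossed_counit (B p.1) : k) *: B p.2) (comul x) = x.
Proof.
move: x; apply: linear_eq_basis => [a u v|//|[l c]].
  by rewrite crossed_comul_linear linearP.
rewrite crossed_comul_basis linear_sum (bigD1 1%g) //= big1 => [|u u1].
  rewrite linearZ /= lin_ext_basis /= crossed_counit_basis eqxx invg1 mul1g.
  by rewrite (tau_norml tauP) !scale1r addr0.
by rewrite linearZ /= lin_ext_basis /= crossed_counit_basis (negbTE u1) scale0r scaler0.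
Qed.

Lemma crossed_counitr (x : 'V[k]_(L * Gam)%type) :
  lin_ext (fun p : (L * Gam) * (L * Gam) =>
    (crossed_counit (B p.2) : k) *: B p.1) (comul x) = x.
Proof.
move: x; apply: linear_eq_basis => [a u v|//|[l c]].
  by rewrite crossed_comul_linear linearP.
rewrite crossed_comul_basis linear_sum (bigD1 l) //= big1 => [|u ul].
  rewrite linearZ /= lin_ext_basis /= crossed_counit_basis mulVg eqxx.
  by rewrite (tau_normr tauP) !scale1r addr0.
rewrite linearZ /= lin_ext_basis /= crossed_counit_basis -eq_invg_mul.
by rewrite invgK (negbTE ul) scale0r scaler0.
Qed.

(** * Antipode axioms *)

Lemma antipode_indexK : involutive antipode_index.
Proof. by case=> l c; rewrite /antipode_index /= -ractV invgK actK invgK. Qed.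

Lemma antipode_coef_neq0 p : antipode_coef p != 0.
Proof. by rewrite invr_eq0 mulf_neq0 ?(tau_neq0 tauP) ?(sigma_neq0 sigmaP). Qed.

Lemma crossed_antipode_bij : bijective crossed_antipode.
Proof.
(* The antipode permutes the basis up to nonzero scalars; [T] applies the same involution with the
   scalar that the antipode contributes at the image index, inverted. *)
pose T : 'V[k]_(L * Gam)%type -> 'V[k]_(L * Gam)%type :=
  lin_ext (fun p => (antipode_coef (antipode_index p))^-1 *: B (antipode_index p)).
have lS : linear crossed_antipode by move=> a u v; rewrite linearP.
have lT : linear T by move=> a u v; rewrite /T linearP.
have ZS a v : crossed_antipode (a *: v) = a *: crossed_antipode v by rewrite linearZ.
have ZT a v : T (a *: v) = a *: T v by rewrite /T linearZ.
have TB p : T (B p) = (antipode_coef (antipode_index p))^-1 *: B (antipode_index p).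
  exact: lin_ext_basis.
exists T.
  apply: linear_eq_basis => [a u v|//|p]; first by rewrite lS lT.
  rewrite crossed_antipode_basis ZT TB antipode_indexK scalerA.
  by rewrite divff ?antipode_coef_neq0 ?scale1r.
apply: linear_eq_basis => [a u v|//|p]; first by rewrite lT lS.
rewrite TB ZS crossed_antipode_basis antipode_indexK scalerA.
by rewrite mulVf ?antipode_coef_neq0 ?scale1r.
Qed.

Lemma crossed_antipodel (x : 'V[k]_(L * Gam)%type) :
  mul (tensor_map crossed_antipode id (comul x)) =
    (crossed_counit x : k) *: crossed_one.
Proof.
move: x; apply: linear_eq_basis => [a u v|a u v|[l c]].
- by rewrite crossed_comul_linear tensor_map_linear crossed_mul_linear.
- by rewrite linearP /= scalerDl scalerA.
rewrite crossed_comul_basis (linear_fun_sumZ _ _ (@tensor_map_linear _ _ _ _ _ _ _)).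
rewrite (linear_fun_sumZ _ _ crossed_mul_linear) crossed_counit_basis scaler_sumr.
(* The summand of [u] on the left lies on [B (u^-1 <| c, 1)], so the sum defining the unit is
   reindexed by [u |-> u^-1 <| c]. *)
rewrite [RHS](reindex_inj (can_inj (actK (mp_ract M) c))).
rewrite [RHS](reindex_inj invg_inj); apply: eq_bigr => u _.
rewrite tensor_map_basis crossed_antipode_basis tensZl linearZ /=.
rewrite crossed_mul_basis /= actK mulVg !scalerA.
have -> : (u^-1 == u^-1 * l)%g = (l == 1%g).
  by rewrite -{1}[u^-1%g]mulg1 (inj_eq (mulgI _)) eq_sym.
have [->|] := eqVneq l 1%g; last by rewrite !(mul0r, mulr0).
rewrite mulg1 mul1r mulrAC /antipode_coef /= divff //.
by rewrite mulf_neq0 ?(tau_neq0 tauP) ?(sigma_neq0 sigmaP).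
Qed.

(** Right antipode axiom: it holds because the cocycle conditions give
    [tau_c(u, u^-1) = tau_c(u^-1, u)] and
    [sigma_u(c, c^-1) = sigma_(u <| c)(c^-1, c)]. *)
Lemma antipode_coef_sym u c :
  antipode_coef (u^-1%g, c) * (tau c u u^-1%g * sigma u c c^-1%g) = 1.
Proof.
rewrite /antipode_coef /= !invgK.
have := tau_cocycleP tauP c u u^-1%g u; rewrite lact_trivial mulgV mulVg.
rewrite (tau_norml tauP) (tau_normr tauP) !mul1r => <-.
have := sigma_cocycleP sigmaP u c c^-1%g c; rewrite mulgV mulVg.
rewrite (sigma_norml sigmaP) (sigma_normr sigmaP) !mulr1 => <-.
by rewrite mulVf // mulf_neq0 ?(tau_neq0 tauP) ?(sigma_neq0 sigmaP).
Qed.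

Lemma crossed_antipoder (x : 'V[k]_(L * Gam)%type) :
  mul (tensor_map id crossed_antipode (comul x)) =
    (crossed_counit x : k) *: crossed_one.
Proof.
move: x; apply: linear_eq_basis => [a u v|a u v|[l c]].
- by rewrite crossed_comul_linear tensor_map_linear crossed_mul_linear.
- by rewrite linearP /= scalerDl scalerA.
rewrite crossed_comul_basis (linear_fun_sumZ _ _ (@tensor_map_linear _ _ _ _ _ _ _)).
rewrite (linear_fun_sumZ _ _ crossed_mul_linear) crossed_counit_basis scaler_sumr.
(* Here the summand of [u] already lies on [B (u, 1)], so the sums match term by term. *)
apply: eq_bigr => u _.
rewrite tensor_map_basis crossed_antipode_basis tensZr linearZ /=.
rewrite crossed_mul_basis /= mulgV !scalerA (inj_eq (act_inj _ _)).
have -> : (u == (u^-1 * l)^-1)%g = (l == 1%g).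
  by rewrite invMg invgK -{1}[u]mul1g (inj_eq (mulIg _)) eq_sym eq_invg1.
have [->|] := eqVneq l 1%g; last by rewrite !(mul0r, mulr0).
by rewrite mulg1 mul1r mulrAC mulrC antipode_coef_sym.
Qed.

(** * Grading by [z], and compatibility of the product with the coproduct *)

Section ColorStructure.

Hypothesis sigma1 : forall c e : Gam, sigma 1%g c e = 1.
Hypothesis tau1 : forall l t : L, tau 1%g l t = 1.

Variables (G : finGroupType) (beta : G -> G -> k) (z : Gam -> L -> G).
Hypothesis zP : Z1_Hom M z.
Hypothesis sigma_z : forall (l t : L) (c e : Gam),
  sigma (l * t)%g c e
    = beta (z c t) (Hom_act M c (z e) l) * sigma l c e * sigma t c e.

Local Notation d := (crossed_deg z).

Lemma Z1_Hom1 c : z c 1%g = 1%g.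
Proof. by apply: (mulgI (z c 1%g)); rewrite -(Z1_mem zP) !mulg1. Qed.

Lemma Z1_HomV c l : z c l^-1%g = (z c l)^-1%g.
Proof. by apply: (mulgI (z c l)); rewrite -(Z1_mem zP) !mulgV Z1_Hom1. Qed.

Lemma basis_vec_neq0 (I : finType) (i j : I) : B i j != 0 -> i = j.
Proof. by rewrite ffunE; case: (i =P j) => //; rewrite mulr0n eqxx. Qed.

(** A nonzero product forces [t = l <| c], and then the degrees match by the 1-cocycle identity of
    [z]. *)
Lemma crossed_mul_graded : graded_map (tensor_deg d d) d mul.
Proof.
apply: graded_map_basis crossed_mul_linear _ => -[[l c] [t e]] j.
rewrite crossed_mul_pair ffunE scaler_eq0 mulf_eq0.
have [<-|_] := eqVneq (l <|[M] c)%g t; last by rewrite eqxx.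
rewrite !negb_or => /andP[_ /basis_vec_neq0 <-].
by rewrite /tensor_deg /d /= (Z1_cocycle zP).
Qed.

Lemma crossed_one_graded : homogeneous d 1%g crossed_one.
Proof.
move=> [l c]; rewrite sum_ffunE; apply: contraNeq => dl.
rewrite big1 // => t _; apply/eqP; apply: contraNT dl.
by move/basis_vec_neq0 => -[_ <-]; rewrite /d /= (Z1_norm zP).
Qed.

(** The degrees match because each [z c] is a homomorphism, applied to [l = u (u^-1 l)]. *)
Lemma crossed_comul_graded : graded_map d (tensor_deg d d) comul.
Proof.
apply: graded_map_basis crossed_comul_linear _ => -[l c] j.
rewrite crossed_comul_basis sum_ffunE; apply: contraNeq => dj.
rewrite big1 // => u _; apply/eqP; apply: contraNT dj.
rewrite ffunE scaler_eq0 negb_or => /andP[_ /basis_vec_neq0 <-].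
by rewrite /tensor_deg /d /= -(Z1_mem zP) mulKVg.
Qed.

Lemma crossed_counit_graded g (x : 'V[k]_(L * Gam)%type) :
  homogeneous d g x -> crossed_counit x != 0 -> g = 1%g.
Proof.
move=> hx; rewrite /crossed_counit /lin_ext; apply: contraNeq => g1.
rewrite big1 // => -[l c] _ /=; have [->|_] := eqVneq l 1%g; last by rewrite scaler0.
apply/eqP; rewrite scaler_eq0; apply/orP; left; apply: contraNT g1 => /hx <-.
by rewrite /d /= Z1_Hom1.
Qed.

Lemma crossed_antipode_graded : graded_map d d crossed_antipode.
Proof.
apply: graded_map_basis => [a u v|[l c] j]; first by rewrite linearP.
rewrite crossed_antipode_basis ffunE scaler_eq0 negb_or => /andP[_ /basis_vec_neq0 <-].
rewrite /d /= ractV Z1_HomV; apply: (mulIg (z c^-1%g (l <|[M] c)%g)).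
(* The cocycle identity at [(c, c^-1)] says that [z c^-1 (l <| c)] is the inverse of [z c l]. *)
have := Z1_cocycle zP c c^-1%g l; rewrite mulgV (Z1_norm zP) /Hom_act => e.
by rewrite mulVg -e.
Qed.

Lemma crossed_comul1 : comul crossed_one = tens crossed_one crossed_one.
Proof.
rewrite (linear_fun_sum _ crossed_comul_linear) (linear_fun_sum _ (@tens_linearl _ _ _ _)).
under eq_bigr do rewrite crossed_comul_basis.
rewrite exchange_big; apply: eq_bigr => u _ /=.
(* The substitution [l = u t] turns the coproduct of the unit into a sum over all pairs [(u, t)],
   with coefficients [tau 1 u t = 1]. *)
rewrite (linear_fun_sum _ (@tens_linearr _ _ _ _)) (reindex_inj (mulgI u)).
by apply: eq_bigr => t _; rewrite mulKg tau1 scale1r tens_basis.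
Qed.

Lemma crossed_counitM (x y : 'V[k]_(L * Gam)%type) :
  crossed_counit (mul (tens x y)) = (crossed_counit x : k) * crossed_counit y.
Proof.
move: x; apply: linear_eq_basis => [a u v|a u v|[l c]].
- by rewrite crossed_mul_linearl linearP.
- by rewrite linearP /= /GRing.scale /= mulrDl mulrA.
move: y; apply: linear_eq_basis => [a u v|a u v|[t e]].
- by rewrite crossed_mul_linearr linearP.
- by rewrite linearP /= /GRing.scale /= mulrDr mulrCA.
rewrite crossed_mul_basis linearZ /= !crossed_counit_basis /GRing.scale /=.
have [->|_] := eqVneq l 1%g; last by rewrite mulr0 mul0r.
by rewrite ract1g sigma1 !mulr1 mul1r eq_sym.
Qed.

Lemma crossed_counit1 : crossed_counit crossed_one = 1.
Proof.
rewrite linear_sum (bigD1 1%g) //= big1 => [|l l1].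
  by rewrite crossed_counit_basis eqxx addr0.
by rewrite crossed_counit_basis (negbTE l1).
Qed.

(** The scalar in front of the sum is the one that [comul (mul _)] also carries, so multiplicativity
    of the coproduct reduces to comparing coefficients in [tau]. *)
Lemma tensor_square_mul_comul l c t e :
  tensor_square_mul beta d mul (comul (B (l, c))) (comul (B (t, e))) =
    (((l <|[M] c)%g == t)%:R * sigma l c e) *: \sum_u
      (tau c u (u^-1 * l)%g * tau e (u <|[M] c)%g ((u^-1 * l) <|[M] c)%g) *:
        B ((u, (c * e)%g), ((u^-1 * l)%g, (c * e)%g)).
Proof.
rewrite !crossed_comul_basis (linear_fun_sumZ _ _ (@tensor_square_mul_linearl _ _ _ _ _ _ _)).
rewrite scaler_sumr; apply: eq_bigr => u _.
rewrite (linear_fun_sumZ _ _ (@tensor_square_mul_linearr _ _ _ _ _ _ _)).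
(* The first tensor factors, at [u] and [v], have a nonzero product only for [v = u <| c]. *)
rewrite (bigD1 (u <|[M] c)%g) //= big1 => [|v vu]; last first.
  rewrite tensor_square_mul_basis !crossed_mul_pair eq_sym (negbTE vu).
  by rewrite tensZl mul0r scale0r !scaler0.
rewrite addr0 tensor_square_mul_basis !crossed_mul_pair eqxx.
rewrite tensZl tensZr tens_basis !scalerA; congr (_ *: _).
have -> : ((u^-1 * l) <|[M] c == (u <|[M] c)^-1 * t)%g = ((l <|[M] c)%g == t).
  by rewrite ractM ractV (inj_eq (mulgI _)).
have [<-|] := eqVneq; last by rewrite !(mul0r, mulr0).
(* The braiding scalar and the two values of [sigma] combine into [sigma l c e], by the hypothesis
   on [sigma] at the factorisation [l = u (u^-1 l)]. *)
have := sigma_z u (u^-1 * l)%g c e; rewrite mulKVg /Hom_act => ->.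
rewrite -ractV -ractM /d /= !mul1r.
exact: mulrC.
Qed.

End ColorStructure.
End CrossedProductTheory.

(** * The equivalence with the 1-cocycle condition on [tau] *)

Theorem theorem4p16 (k : closedFieldType) (char_k : [pchar k] =i pred0)
    (G : finGroupType) (abelian_G : abelian [set: G])
    (beta : G -> G -> k) (beta_bichar : bicharacter beta)
    (Gam L : finGroupType) (M : matched_pair Gam L)
    (lact_trivial : forall (l : L) (c : Gam), (l |>[M] c)%g = c)
    (sigma : L -> Gam -> Gam -> k) (tau : Gam -> L -> L -> k)
    (sigmaP : sigma_cocycle M sigma) (tauP : tau_cocycle M tau)
    (sigma1 : forall c e : Gam, sigma 1%g c e = 1)
    (tau1 : forall l t : L, tau 1%g l t = 1)
    (z : Gam -> L -> G) (zP : Z1_Hom M z)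
    (sigma_z : forall (l t : L) (c e : Gam),
      sigma (l * t)%g c e
        = beta (z c t) (Hom_act M c (z e) l) * sigma l c e * sigma t c e) :
  color_hopf_algebra beta (crossed_deg z)
    (crossed_mul M sigma) (crossed_comul M tau)
  <-> Z1_Z2 M (tau_tilde tau).
Proof.
(* Since the left action is trivial, each [tau c] is already a normalized 2-cocycle on [L], and
   [tau 1] is trivial; the multiplicative relation is what remains. *)
have tau_coh : Z1_Z2 M (tau_tilde tau) <-> forall c e l t,
    tau (c * e)%g l t = tau c l t * tau e (l <|[M] c)%g (t <|[M] c)%g.
  split=> [tz c e l t|tz]; first exact: Z1_cocycle tz c e (l, t).
  split=> [c|[l t]|c e [l t]]; [|exact: tau1|exact: tz].
  case: tauP => tn tc tl tr; split=> [l t|l t r|t|l]; rewrite /tau_tilde //=.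
  by have := tc c l t r; rewrite lact_trivial mulrC => ->; rewrite mulrC.
split=> [[one [eps [S [[_ _ Dm _ _ _] _]]]]|/tau_coh tz].
  apply/tau_coh => c e l t.
  (* The second vector is chosen so that the product is nonzero; its scalar [sigma (l * t) c e] then
     cancels. *)
  have /= := Dm (basis_vec k ((l * t)%g, c)) (basis_vec k (((l * t) <|[M] c)%g, e)).
  rewrite crossed_mul_basis (tensor_square_mul_comul _ lact_trivial sigma_z).
  rewrite linearZ /= crossed_comul_basis // eqxx mul1r.
  move/(scalerI (sigma_neq0 sigmaP _ _ _)).
  (* The coordinate at [p] isolates the summand [u = l], whose other factor is [l^-1 (l t) = t]. *)
  pose p := ((l, (c * e)%g), (t, (c * e)%g)).
  have coefE (F : L -> k) :
      (\sum_u F u *: basis_vec k ((u, (c * e)%g), ((u^-1 * (l * t))%g, (c * e)%g)) :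
         'V[k]_((L * Gam) * (L * Gam))%type) p = F l.
    rewrite sum_ffunE (bigD1 l) //= big1 => [|u ul]; rewrite !ffunE.
      by rewrite mulKg eqxx addr0 /GRing.scale /= mulr1.
    by rewrite !xpair_eqE (negbTE ul) scaler0.
  by move/ffunP/(_ p); rewrite !coefE mulKg.
exists (crossed_one k Gam L), (@crossed_counit k Gam L), (crossed_antipode M sigma tau).
split; split.
- split; [exact: crossed_mulA|exact: crossed_mul1l|exact: crossed_mul1r| |].
    exact: crossed_mul_graded.
  exact: crossed_one_graded zP.
- split; [exact: crossed_comulA|exact: crossed_counitl|exact: crossed_counitr| |].
    exact: crossed_comul_graded zP.
  exact: crossed_counit_graded zP.
- move=> x y /=; move: x.
  apply: linear_eq_basis => [a u v|a u v|[l c]].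
  + by rewrite crossed_mul_linearl crossed_comul_linear.
  + by rewrite crossed_comul_linear tensor_square_mul_linearl.
  move: y; apply: linear_eq_basis => [a u v|a u v|[t e]].
  + by rewrite crossed_mul_linearr crossed_comul_linear.
  + by rewrite crossed_comul_linear tensor_square_mul_linearr.
  rewrite crossed_mul_basis (tensor_square_mul_comul _ lact_trivial sigma_z).
  rewrite linearZ /= crossed_comul_basis //; congr (_ *: _).
  by apply: eq_bigr => u _; rewrite tz.
- exact: crossed_comul1.
- exact: crossed_counitM.
- exact: crossed_counit1.
- exact: crossed_antipode_graded.
- exact: crossed_antipode_bij.
- exact: crossed_antipodel.
- exact: crossed_antipoder.
Qed.
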